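(* For every finite instance $J=\{1,\dots,n\}$ of jobs with integer data, the minimum number $m$ of identical machines admitting a feasible preemptive schedule satisfies $m=\lceil\rho_s\rceil$, where $\rho_s$ is the strong density of $J$.
   Context: Each job $j$ has integer release date $r_j$, processing time $p_j$ and deadline $d_j$ with $p_j\le d_j-r_j$; $Q_j=[r_j,d_j]$ is its time window and $\ell_j=d_j-r_j-p_j$ its laxity. A feasible preemptive schedule on a number of identical machines processes each job for $p_j$ units within $Q_j$, each machine processing at most one job at a time, no job on two machines at once; preemption and migration are allowed. Let $d_{\max}=\max_j d_j$. For a set $\mathcal{I}$ of pairwise disjoint intervals, $|\mathcal{I}|$ is the sum of their lengths and $\cup\mathcal{I}$ their union. The contribution of job $j$ is $\Gamma_j(\mathcal{I})=\max\{0,|(\cup\mathcal{I})\cap Q_j|-\ell_j\}$. The strong density is $\rho_s=\max_{\mathcal{I}} \frac{\sum_{j=1}^n\Gamma_j(\mathcal{I})}{|\mathcal{I}|}$, where the maximum ranges over nonempty sets $\mathcal{I}\subseteq\{[t,t+1]: t\in\mathbb{Z},\ 0\le t<d_{\max}\}$ of unit time slots.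
   Formalization: Release dates and deadlines are taken to be nonnegative integers, since the slots start at time 0 and the claim fails for negative release dates; when d_max = 0 (no slots) the strong density is taken to be 0. *)

(* Defs.v *)
From mathcomp Require Import all_boot all_order all_algebra.
From mathcomp Require Import all_classical all_reals all_analysis.
Set Implicit Arguments.
Unset Strict Implicit.
Unset Printing Implicit Defensive.
Import Order.TTheory GRing.Theory Num.Theory.
Local Open Scope classical_set_scope.
Local Open Scope ring_scope.

(* Release dates are natural numbers: the time slots used by the strong density
   start at time 0.  The last field is p_j <= d_j - r_j, stated without
   truncated subtraction. *)
Record job := Job {
  release : nat;
  processing : nat;
  deadline : nat;
  job_fits : (release + processing <= deadline)%N
}.

Definition window (R : realType) (j : job) : set R :=
  `[(release j)%:R, (deadline j)%:R].
Arguments window : clear implicits.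

Definition laxity (R : realType) (j : job) : R :=
  (deadline j)%:R - (release j)%:R - (processing j)%:R.

Definition length (R : realType) (A : set R) : R := fine (lebesgue_measure A).

(* Time is continuous: [s i t] is the job run by machine [i] at time [t]
   ([None] when idle), so a machine runs at most one job at a time by
   construction.  Measurability is the only regularity asked of [s]: no bound
   on the number of preemptions or migrations is imposed. *)
Record feasible_schedule (R : realType) (n : nat) (J : 'I_n -> job) (m : nat)
    (s : 'I_m -> R -> option 'I_n) : Prop := FeasibleSchedule {
  schedule_measurable :
    forall i j, measurable [set t : R | s i t = Some j];
  schedule_window :
    forall i j (t : R), s i t = Some j -> window R (J j) t;
  schedule_no_parallel :
    forall i i' j (t : R), s i t = Some j -> s i' t = Some j -> i = i';
  schedule_complete :
    forall j, (\sum_(i < m) lebesgue_measure [set t : R | s i t = Some j]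
               = (processing (J j))%:R%:E)%E
}.

Definition feasible (R : realType) (n : nat) (J : 'I_n -> job) (m : nat) : Prop :=
  exists s : 'I_m -> R -> option 'I_n, feasible_schedule J s.

Definition minimum_machines (R : realType) (n : nat) (J : 'I_n -> job) (m : nat)
    : Prop :=
  feasible R J m /\ forall m' : nat, feasible R J m' -> (m <= m')%N.

Definition dmax (n : nat) (J : 'I_n -> job) : nat := \max_(j < n) deadline (J j).

Definition slot (R : realType) (t : nat) : set R := `[t%:R, t.+1%:R].
Arguments slot : clear implicits.

Section Density.
Variables (R : realType) (n : nat) (J : 'I_n -> job).

(* A set of unit slots [t, t+1], 0 <= t < d_max, is given by the set of the
   left endpoints t. *)
Implicit Type I : {set 'I_(dmax J)}.

Definition slots_length I : R := \sum_(t in I) length (slot R t).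

Definition slots_union I : set R :=
  \bigcup_(t in [set` I]) slot R t.

Definition contribution I (j : 'I_n) : R :=
  Num.max 0 (length (slots_union I `&` window R (J j)) - laxity R (J j)).

(* All the ratios are nonnegative, so the unit 0 of the iterated maximum only
   matters when there is no slot at all (d_max = 0); then there is no work to
   process and the density is 0. *)
Definition strong_density : R :=
  \big[Num.max/0]_(I : {set 'I_(dmax J)} | I != finset.set0)
     ((\sum_(j < n) contribution I j) / slots_length I).

End Density.

(* Main.v *)
(* For a set I of slots, a job j with window slots A_j must receive at least
   p_j - |A_j \ I| units inside I, and this number is exactly its contribution.
   Hence m machines can only suffice if these lower bounds sum to at most m |I|
   for every I, that is, if the strong density is at most m. Conversely, this is
   the Hall condition for choosing, for every job, p_j slots of its window such
   that no slot is chosen by more than m jobs; running every job during the whole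
   of its chosen slots is then feasible. *)
Require Import Defs.
From mathcomp Require Import all_boot all_order all_algebra zify.
Set Implicit Arguments.
Unset Strict Implicit.
Unset Printing Implicit Defensive.

(** * Supermodularity of demand and a Hall theorem with capacities *)

Lemma card_setD_submod (T : finType) (A I1 I2 : {set T}) :
  #|A :\: (I1 :|: I2)| + #|A :\: (I1 :&: I2)| = #|A :\: I1| + #|A :\: I2|.
Proof. by rewrite setDUr setDIr addnC cardsUI. Qed.

Lemma sum_setUI (T : finType) (c : T -> nat) (I1 I2 : {set T}) :
  \sum_(t in I1 :|: I2) c t + \sum_(t in I1 :&: I2) c t =
  \sum_(t in I1) c t + \sum_(t in I2) c t.
Proof.
have E (I : {set T}) : \sum_(t in I) c t = \sum_t (t \in I) * c t.
  by rewrite big_mkcond; apply: eq_bigr => t _; case: (t \in I); rewrite ?mul1n.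
rewrite !E -!big_split; apply: eq_bigr => t _ /=.
by rewrite !inE; case: (t \in I1); case: (t \in I2) => /=; lia.
Qed.

Section CapacitatedHall.
Variables (J T : finType).
Implicit Types (A X : J -> {set T}) (p : J -> nat) (c : T -> nat) (I : {set T}).

(** Truncated subtraction plays the role of the maximum with 0 in the contribution. *)
Definition demand A p I := \sum_j (p j - #|A j :\: I|).

(** Truncation at 0 is convex and [#|A k :\: I|] is modular and decreasing in [I], so every summand
    is supermodular. The summand of [j] is untruncated at [I1] and 0 at [I2], and adding [t] to [I1]
    strictly raises it. *)
Lemma demand_supermod A p j t I1 I2 :
  t \in A j -> t \notin I1 -> t \in I2 ->
  #|A j :\: I1| <= p j <= #|A j :\: I2| ->
  demand A p I1 + demand A p I2 <
    demand A p (I1 :|: I2) + demand A p (I1 :&: I2).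
Proof.
move=> tA t1 t2 /andP[h1 h2]; rewrite /demand -!big_split /=.
rewrite !(bigD1 j (P := predT)) //= -addSn; apply: leq_add.
  have := card_setD_submod (A j) I1 I2.
  have : #|A j :\: (I1 :|: I2)| < #|A j :\: I1|.
    apply: proper_card; apply/properP; split; first by rewrite setDS ?subsetUl.
    by exists t; rewrite !inE ?t1 ?tA ?t2 ?orbT.
  lia.
apply: leq_sum => k _; have := card_setD_submod (A k) I1 I2.
have := subset_leq_card (setDS (A k) (subsetUl I1 I2)).
have := subset_leq_card (setDS (A k) (subsetUr I1 I2)).
lia.
Qed.

(** Used with [f] the summands of a demand where only the data of [j] changed; an identity between
    sums stays exact in [nat]. *)
Lemma demandD1 A p j I (f : J -> nat) :
  (forall k, k != j -> f k = p k - #|A k :\: I|) ->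
  \sum_k f k + (p j - #|A j :\: I|) = demand A p I + f j.
Proof.
move=> fE; rewrite /demand !(bigD1 j (P := predT)) //= (eq_bigr _ fE).
by rewrite addnC [f j + _]addnC addnA.
Qed.

(* An edge [t \in A j] can be either deleted or put into [X j] without breaking
   the condition: otherwise the two violated sets [I1], avoiding [t], and [I2],
   containing [t], are tight for [A], against strict supermodularity. *)
Lemma capacitated_hall A p c :
  (forall I, demand A p I <= \sum_(t in I) c t) ->
  exists X, [/\ forall j, X j \subset A j, forall j, #|X j| = p j &
    forall t, #|[set j | t \in X j]| <= c t].
Proof.
(* Induction on the number of edges; [p] and [c] vary because putting an edge into [X] lowers
   both. *)
have [N] := ubnP (\sum_j #|A j|); elim: N A p c => // N IH A p c ltN hall.
have [/existsP[j /set0Pn[t tA]]|/existsPn A0] := boolP [exists j, A j != set0];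
  last first.
  have {}A0 j : A j = set0 by apply/eqP; have := A0 j; rewrite negbK.
  exists (fun=> set0); split=> [j|j|t]; first exact: sub0set.
    (* With no edge left, the condition at the empty set forces every [p j] to be 0. *)
    have := hall set0; rewrite /demand big_set0 leqn0 sum_nat_eq0.
    by move=> /forallP/(_ j) /=; rewrite A0 set0D cards0 subn0 => /eqP.
  by rewrite (_ : finset _ = set0) ?cards0 //; apply/setP=> j; rewrite !inE.
pose A' k := if k == j then A j :\ t else A k.
have A'j : A' j = A j :\ t by rewrite /A' eqxx.
have A'k k : k != j -> A' k = A k by rewrite /A' => /negPf->.
have A'A k : A' k \subset A k.
  by rewrite /A'; case: eqP => [->|_] //; rewrite subsetDl.
have ltN' : \sum_k #|A' k| < N.
  rewrite -ltnS; apply: leq_trans ltN; rewrite ltnS.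
  rewrite !(bigD1 j (P := predT)) //= A'j (cardsD1 t (A j)) tA.
  by rewrite -addSn leq_add //; apply: leq_sum => k /A'k->.
have cardA' I : #|A j :\: I| = (t \notin I) + #|A' j :\: I|.
  rewrite A'j (cardsD1 t) !inE tA andbT; congr (_ + #|pred_of_set _|).
  by apply/setP=> x; rewrite !inE; case: (x == t); case: (x \in I).
have delE I :
    demand A' p I + (p j - #|A j :\: I|) = demand A p I + (p j - #|A' j :\: I|).
  by apply: demandD1 => k /A'k->.
have [/forallP del|/forallPn[I1]] :=
    boolP [forall I, demand A' p I <= \sum_(t in I) c t].
  have [X [XA Xp Xc]] := IH _ _ _ ltN' del.
  by exists X; split=> // k; apply: subset_trans (XA k) _.
rewrite -ltnNge => viol1.
(* The deletion raises the demand by at most 1, and only if [t] is outside [I1] and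
   [#|A j :\: I1| <= p j]; a violation therefore makes [I1] tight for [A]. *)
have [t1 [I1p I1tight]] : t \notin I1 /\
    (#|A j :\: I1| <= p j /\ demand A p I1 = \sum_(t in I1) c t).
  have := hall I1; have := delE I1; have := cardA' I1.
  by case: (t \in I1) => /=; split=> //; lia.
(* Capacity sums are modular, so such an [I2] together with [I1] would violate the condition at
   their union or intersection. *)
have hallC I2 : t \in I2 -> p j <= #|A j :\: I2| -> \sum_(t in I2) c t <= demand A p I2 ->
    False.
  move=> t2 I2p I2tight; have := demand_supermod (p := p) tA t1 t2.
  rewrite I1p I2p => /(_ isT).
  have := sum_setUI c I1 I2; have := hall (I1 :|: I2); have := hall (I1 :&: I2); lia.
have pj_gt0 : 0 < p j.
  by have := delE I1; have := hall I1; have := cardA' I1; rewrite t1; lia.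
(* With [c t] equal to 0, the set [[set t]] would have demand 0 and be tight, which [hallC]
   excludes. *)
have ct_gt0 : 0 < c t.
  rewrite lt0n; apply/negP=> /eqP ct0; apply: (hallC [set t]); rewrite ?inE ?eqxx //.
    have := hall [set t]; rewrite big_set1 ct0 /demand leqn0 sum_nat_eq0.
    by move=> /forallP/(_ j); rewrite implyTb subn_eq0.
  by rewrite big_set1 ct0.
(* Putting [t] into [X j] consumes one unit of the demand of [j] and one of the capacity of [t]. *)
pose p' k := p k - (k == j).
pose c' s := c s - (s == t).
have c'E I : \sum_(s in I) c' s + (t \in I) = \sum_(s in I) c s.
  case: (boolP (t \in I)) => tI.
    rewrite !(bigD1 t tI) /= /c' eqxx.
    rewrite (eq_bigr c) ?[RHS]/= => [|s /andP[_ /negPf->]]; last by rewrite subn0.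
    by rewrite addnAC subn1 addn1 prednK.
  rewrite addn0; apply: eq_bigr => s sI; rewrite /c'.
  by rewrite (_ : s == t = false) ?subn0 //; apply: contraNF tI => /eqP<-.
have useE I :
    demand A' p' I + (p j - #|A j :\: I|) = demand A p I + (p' j - #|A' j :\: I|).
  by apply: demandD1 => k kj; rewrite A'k // /p' (negPf kj) subn0.
have p'j : p' j = (p j).-1 by rewrite /p' eqxx subn1.
have hall' I : demand A' p' I <= \sum_(s in I) c' s.
  (* If [t] is outside [I], the lost edge offsets the lost unit of [p j], and nothing changes.
     Otherwise the capacity drops by 1, so a violation means that the demand did not drop, hence
     [p j <= #|A j :\: I|], and that [I] was tight: [hallC] applies. *)
  rewrite leqNgt; apply/negP=> viol2.
  have := hall I; have := c'E I; have := useE I; have := cardA' I; have := @hallC I.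
  rewrite p'j; case: (t \in I) => /= [/(_ isT)|_] h *; last lia.
  by apply: h; lia.
have [X [XA Xp Xc]] := IH _ _ _ ltN' hall'.
have tX : t \notin X j by apply/negP=> /(subsetP (XA j)); rewrite A'j !inE eqxx.
exists (fun k => if k == j then t |: X j else X k); split=> [k|k|s].
- case: eqP => [->|_]; last exact: subset_trans (XA k) (A'A k).
  by rewrite subUset sub1set tA (subset_trans (XA j) (A'A j)).
- case: eqP => [->|/eqP kj]; first by rewrite cardsU1 tX Xp p'j add1n prednK.
  by rewrite Xp /p' (negPf kj) subn0.
- have [->|st] := eqVneq s t.
    rewrite (_ : finset _ = j |: [set k | t \in X k]); last first.
      by apply/setP=> k; rewrite !inE; case: eqP => [->|]; rewrite ?inE ?eqxx.
    rewrite cardsU1 inE tX; have := Xc t; rewrite /c' eqxx; lia.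
  rewrite (_ : finset _ = [set k | s \in X k]).
    by have := Xc s; rewrite /c' (negPf st) subn0.
  by apply/setP=> k; rewrite !inE; case: eqP => [->|]; rewrite ?inE ?(negPf st).
Qed.

End CapacitatedHall.

(** * Slots of a job and their distribution over machines *)

Definition job_slots (n : nat) (J : 'I_n -> job) (j : 'I_n) : {set 'I_(dmax J)} :=
  [set t : 'I_(dmax J) | release (J j) <= t < deadline (J j)].

Lemma card_job_slots (n : nat) (J : 'I_n -> job) (j : 'I_n) :
  #|job_slots J j| = deadline (J j) - release (J j).
Proof.
have dD : deadline (J j) <= dmax J := leq_bigmax (F := fun k => deadline (J k)) j.
rewrite /job_slots cardsE -sum1_card.
rewrite -(big_mkord (fun t => release (J j) <= t < deadline (J j)) (fun=> 1)).
rewrite -(big_nat_widen _ _ _ (fun t => release (J j) <= t)) //.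
by rewrite -(big_nat_widenl _ 0 _ predT) // sum_nat_const_nat muln1.
Qed.

Section Machines.
Variables (K T : finType) (X : K -> {set T}).

(* At each [t], machine [i] takes the [i]-th of the [k] with [t \in X k] in
   enumeration order, so [m] machines suffice when no [t] has more than [m]. *)
Definition machine_slots (i : nat) (k : K) : {set T} :=
  [set t | onth (enum [set l | t \in X l]) i == Some k].

Lemma machine_slots_sub i k : machine_slots i k \subset X k.
Proof.
apply/subsetP=> t; rewrite inE => /eqP ti.
have /onthP : exists i, onth (enum [set l | t \in X l]) i = Some k by exists i.
by rewrite mem_enum inE.
Qed.

(** An enumeration lists [k] only once; this will keep a job from running on two machines at
    once. *)
Lemma machine_slots_inj i i' k t :
  t \in machine_slots i k -> t \in machine_slots i' k -> i = i'.
Proof.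
rewrite !inE => /eqP ti /eqP ti'; apply: (@onth_inj _ (enum [set l | t \in X l])).
- exact: enum_uniq.
- by rewrite gtn_min -(onthTE _ i) ti orbT.
- by rewrite ti ti'.
Qed.

(** Each [t] in [X k] is counted exactly once: [k] has one position in the enumeration at [t], and
    the load bound puts it below [m]. *)
Lemma sum_card_machine_slots m k :
  (forall t, #|[set l | t \in X l]| <= m) -> \sum_(i < m) #|machine_slots i k| = #|X k|.
Proof.
move=> load; under eq_bigr do rewrite -sum1_card big_mkcond.
rewrite exchange_big -[RHS]sum1_card [RHS]big_mkcond; apply: eq_bigr => t _ /=.
have [tk|tNk] := boolP (t \in X k); last first.
  by apply: big1 => i _; case: ifP => // /(subsetP (machine_slots_sub i k));
    rewrite (negPf tNk).
have /onthP[i ti] : k \in enum [set l | t \in X l] by rewrite mem_enum inE.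
have im : i < m.
  by apply: leq_trans (load t); rewrite cardE -onthTE ti.
have tik : t \in machine_slots i k by rewrite inE ti.
rewrite (bigD1 (Ordinal im)) //= tik big1 ?addn0 // => i' i'i.
by case: ifP => // /(machine_slots_inj tik) E; case/eqP: i'i; apply/val_inj.
Qed.

End Machines.

(* Imported only now because classical_sets reuses the lemma names of finset. *)
From mathcomp Require Import all_classical all_reals all_analysis.
Import Order.TTheory GRing.Theory Num.Theory.
Local Open Scope classical_set_scope.
Local Open Scope ring_scope.

(** * Measures of finite unions *)

Section FiniteUnions.
Variables (d : measure_display) (T : measurableType d) (R : realType).
Variables (mu : {measure set T -> \bar R}) (K : finType) (F : K -> set T).
Hypothesis mF : forall k, measurable (F k).

Lemma measurable_bigcup_in (P : {set K}) : measurable (\bigcup_(k in [set` P]) F k).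
Proof. exact: fin_bigcup_measurable. Qed.

Lemma measure_bigcup_le (P : {set K}) :
  (mu (\bigcup_(k in [set` P]) F k) <= \sum_(k in P) mu (F k))%E.
Proof.
rewrite (bigfs _ _ (P := mem P)) ?index_enum_uniq //; last first.
  by move=> i _; rewrite mem_index_enum.
apply: (@content_sub_fsum _ _ _ mu _ _ _ F) => //.
exact: measurable_bigcup_in.
Qed.

Hypothesis F_inj : forall k l x, F k x -> F l x -> k = l.

Lemma measure_bigcup_in (P : {set K}) :
  mu (\bigcup_(k in [set` P]) F k) = (\sum_(k in P) mu (F k))%E.
Proof.
rewrite (bigfs _ _ (P := mem P)) ?index_enum_uniq //; last first.
  by move=> i _; rewrite mem_index_enum.
by apply: measure_fin_bigcup => // k l _ _ [x [Fk Fl]]; exact: F_inj Fk Fl.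
Qed.

(** Serves twice: over the machines for a fixed job, and over the jobs for a fixed machine. *)
Lemma sum_measureI_le (H : set T) : measurable H ->
  (\sum_k mu (F k `&` H) <= mu H)%E.
Proof.
move=> mH.
suff <- : mu (\bigcup_(k in [set` [set: K]%SET]) (F k `&` H)) = (\sum_k mu (F k `&` H))%E.
  rewrite -setI_bigcupl; apply: measureIr => //; exact: measurable_bigcup_in.
rewrite (bigfs _ _ (P := mem predT)) ?index_enum_uniq //; last first.
  by move=> i _; rewrite mem_index_enum.
rewrite (_ : [set` [set: K]%SET] = [set` predT]).
  apply: measure_fin_bigcup => [|k l _ _ [x [[Fk _] [Fl _]]]|k _].
  - exact: finite_finset.
  - exact: F_inj Fk Fl.
  - exact: measurableI.
by apply/seteqP; split=> k //= _; rewrite inE.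
Qed.

End FiniteUnions.

(** * Unit cells of the time axis *)

Section Cells.
Variables (R : realType) (D : nat).
Implicit Types (P I : {set 'I_D}).
Notation mu := (@lebesgue_measure R).

(* Half-open, so that distinct cells are disjoint. *)
Definition cell (t : nat) : set R := `[t%:R, t.+1%:R[.
Definition cells P : set R := \bigcup_(t in [set` P]) cell t.

Lemma measurable_cell t : measurable (cell t).
Proof. exact: measurable_itv. Qed.

Lemma cell_inj t t' x : cell t x -> cell t' x -> t = t'.
Proof.
rewrite /cell /= !in_itv /= => /andP[a b] /andP[c d].
have := le_lt_trans a d; have := le_lt_trans c b; rewrite !ltr_nat; lia.
Qed.

Lemma measure_cell t : mu (cell t) = 1%E.
Proof.
rewrite lebesgue_measure_itv /= lte_fin ltr_nat ltnSn -EFinB.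
by rewrite -natrB // subSnn.
Qed.

Lemma measure_slot t : mu (slot R t) = 1%E.
Proof.
rewrite lebesgue_measure_itv /= lte_fin ltr_nat ltnSn -EFinB.
by rewrite -natrB // subSnn.
Qed.

Lemma measurable_cells P : measurable (cells P).
Proof. by apply: measurable_bigcup_in => t; exact: measurable_cell. Qed.

Lemma sum_one_ereal P : (\sum_(t in P) 1 = (#|P|%:R : R)%:E)%E.
Proof. by rewrite sumEFin -sumr_const. Qed.

Lemma measure_cells P : mu (cells P) = (#|P|%:R : R)%:E.
Proof.
rewrite measure_bigcup_in; first last.
- by move=> k l x /cell_inj kl /kl /val_inj.
- by move=> k; exact: measurable_cell.
by rewrite -sum_one_ereal; apply: eq_bigr => t _; exact: measure_cell.
Qed.

(** The cell of [x] is given by its integer part; being half-open, the cells miss only the endpoint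
    [d]. *)
Lemma window_cover (r d : nat) (P : {set 'I_D}) (x : R) : (d <= D)%N ->
  (forall t, (t \in P) = (r <= t < d)%N) ->
  r%:R <= x <= d%:R -> cells P x \/ x = d%:R.
Proof.
move=> dD PE /andP[rx xd]; have [->|xNd] := eqVneq x d%:R; first by right.
left; have x0 : 0 <= x by apply: le_trans rx.
have /andP[tx xt] := truncn_itv x0.
have xd' : x < d%:R by rewrite lt_neqAle xNd.
have td : (Num.truncn x < d)%N by rewrite -(ltr_nat R); apply: le_lt_trans xd'.
have rt : (r <= Num.truncn x)%N by rewrite -ltnS -(ltr_nat R); apply: le_lt_trans xt.
exists (Ordinal (leq_trans td dD)) => /=; first by rewrite PE /= rt td.
by rewrite /cell /= in_itv /= tx xt.
Qed.

End Cells.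
Arguments cell : clear implicits.
Arguments cells R {D} P.

(** * Strong density, demand and feasibility *)

Section Instance.
Variables (R : realType) (n : nat) (J : 'I_n -> job).
Implicit Type I : {set 'I_(dmax J)}.
Notation mu := (@lebesgue_measure R).
Notation work := (fun j => processing (J j)).

Lemma measurable_slot t : measurable (slot R t).
Proof. exact: measurable_itv. Qed.

(* Restates [measurable_set1] for the type on which [lebesgue_measure] is
   declared; the two measurable structures are only convertible. *)
Lemma measurable_pt (x : R) : measurable ([set x] : set (measurableTypeR R)).
Proof. exact: measurable_set1. Qed.

Lemma mem_job_slots j (t : 'I_(dmax J)) :
  (t \in job_slots J j) = (release (J j) <= t < deadline (J j))%N.
Proof. by rewrite inE. Qed.

Lemma window_job_slots j (x : R) : window R (J j) x ->
  cells R (job_slots J j) x \/ x = (deadline (J j))%:R.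
Proof.
rewrite /window /= in_itv /=; apply: window_cover; last exact: mem_job_slots.
exact: (leq_bigmax (F := fun k => deadline (J k)) j).
Qed.

Lemma cell_window j (t : 'I_(dmax J)) (x : R) :
  t \in job_slots J j -> cell R t x -> window R (J j) x.
Proof.
rewrite mem_job_slots /cell /window /= !in_itv /= => /andP[rt td] /andP[tx xt].
rewrite (le_trans _ tx) ?ler_nat //= (le_trans (ltW xt)) // ler_nat //.
Qed.

(** Subadditivity over the closed slots gives the upper bound, the disjoint half-open cells inside
    them the lower one. *)
Lemma length_slots_window I j :
  length (@slots_union R n J I `&` window R (J j)) =
  #|(job_slots J j :&: I)%SET|%:R.
Proof.
set P := (job_slots J j :&: I)%SET.
have mU (Q : {set 'I_(dmax J)}) :
    measurable (\bigcup_(t in [set` Q]) slot R t : set (measurableTypeR R)).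
  by apply: (measurable_bigcup_in (F := fun t : 'I_(dmax J) => slot R t)) => t;
    exact: measurable_slot.
have mUW : measurable (@slots_union R n J I `&` window R (J j) : set (measurableTypeR R)).
  by apply: measurableI; [exact: mU|exact: measurable_itv].
suff muE : mu (@slots_union R n J I `&` window R (J j)) = (#|P|%:R : R)%:E.
  by rewrite /length muE.
apply/eqP; rewrite eq_le; apply/andP; split.
  (* A slot outside the window meets it at most at an endpoint of the window, hence within the null
     set [E]. *)
  pose E : set (measurableTypeR R) :=
    [set (release (J j))%:R] `|` [set (deadline (J j))%:R].
  have mE : measurable E by apply: measurableU; exact: measurable_pt.
  have muE : mu E = 0%E.
    rewrite measureU0; [exact: lebesgue_measure_set1|exact: measurable_pt..|].
    exact: lebesgue_measure_set1.
  rewrite -(sum_one_ereal R P).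
  apply: (@le_trans _ _ (mu ((\bigcup_(t in [set` P]) slot R t) `|` E))).
    apply: le_measure; rewrite ?inE //; first exact: measurableU.
    move=> x [[t /= tI tx] jx]; have [tj|tNj] := boolP (t \in job_slots J j).
      by left; exists t => //=; rewrite /P finset.inE tj tI.
    right; move: tNj tx jx; rewrite mem_job_slots /window /slot /= !in_itv /=.
    rewrite negb_and -!ltnNge => /orP[tr|dt] /andP[tx xt] /andP[rx xd].
      by left; apply: le_anti; rewrite rx (le_trans xt) ?ler_nat.
    by right; apply: le_anti; rewrite xd (le_trans _ tx) ?ler_nat.
  rewrite measureU0 //; apply: le_trans (measure_bigcup_le _ _ _) _.
    by move=> t; exact: measurable_slot.
  by apply: lee_sum => t _; rewrite le_eqVlt;
    apply/orP; left; apply/eqP; exact: measure_slot.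
rewrite -(measure_cells R P); apply: le_measure; rewrite ?inE //.
  exact: measurable_cells.
move=> x [t /=]; rewrite finset.inE => /andP[tj tI] tx; split; last exact: cell_window tx.
by exists t => //; move: tx; rewrite /cell /slot /= !in_itv /= => /andP[-> /ltW->].
Qed.

(** With A the slots of [j], |A| = d - r gives |A ∩ I| - (d - r - p) = p - |A \ I|. *)
Lemma contributionE I j :
  contribution R I j = (processing (J j) - #|(job_slots J j :\: I)%SET|)%N%:R.
Proof.
rewrite /contribution length_slots_window /laxity; have fits := job_fits (J j).
have := card_job_slots J j; have := finset.cardsID I (job_slots J j).
move: #|_| #|_| #|_| => a b c abc cE.
move: (release _) (deadline _) (processing _) fits cE => r d p fits cE.
have -> : d%:R - r%:R - p%:R = (d - r - p)%N%:R :> R by rewrite !natrB //; lia.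
have [pb|bp] := leqP p b.
  by rewrite (eqP pb) max_l // subr_le0 ler_nat; lia.
rewrite max_r ?subr_ge0 ?ler_nat; last by lia.
by rewrite -natrB; [congr (_%:R)|]; lia.
Qed.

Lemma slots_lengthE I : @slots_length R n J I = #|I|%:R.
Proof.
rewrite /slots_length -sumr_const; apply: eq_bigr => t _.
by rewrite /length measure_slot.
Qed.

(** Clearing denominators turns the density bound into the Hall condition with constant capacity
    [m]. *)
Lemma strong_density_leP m :
  strong_density R J <= m%:R <->
  forall I, (demand (job_slots J) work I <= m * #|I|)%N.
Proof.
have ratioE I : I != finset.set0 ->
    ((\sum_(j < n) contribution R I j) / @slots_length R n J I <= m%:R) =
    (demand (job_slots J) work I <= m * #|I|)%N.
  move=> I0; rewrite slots_lengthE ler_pdivrMr ?ltr0n ?finset.card_gt0 //.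
  under eq_bigr do rewrite contributionE.
  by rewrite -natr_sum -natrM ler_nat.
split=> [/bigmax_leP[_ le_m] I|le_m].
  (* The density omits the empty set, where the inequality reads p <= d - r, supplied by
     [job_fits]. *)
  have [->|I0] := eqVneq I finset.set0; last by rewrite -ratioE // le_m.
  rewrite finset.cards0 muln0 leqn0 sum_nat_eq0; apply/forallP=> j.
  rewrite implyTb subn_eq0 finset.setD0 card_job_slots.
  have := job_fits (J j); lia.
by apply/bigmax_leP; split=> [|I I0]; rewrite ?ler0n ?ratioE.
Qed.

Lemma feasible_demand m I :
  feasible R J m -> (demand (job_slots J) work I <= m * #|I|)%N.
Proof.
case=> s [mS wS parS doneS].
pose S i j : set (measurableTypeR R) := [set t : R | s i t = Some j].
have mSij i j : measurable (S i j) by exact: mS.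
have mC (Q : {set 'I_(dmax J)}) : measurable (cells R Q : set (measurableTypeR R)).
  exact: measurable_cells.
(* Never running in parallel, [j] gets at most [#|Q|] units on the cells of [Q]; the rest falls in
   those of [I], up to the deadline, a null set. *)
have claim1 j : ((processing (J j) - #|(job_slots J j :\: I)%SET|)%N%:R%:E <=
    \sum_(i < m) mu (S i j `&` cells R I))%E.
  set Q := (job_slots J j :\: I)%SET.
  have le_p : ((processing (J j))%:R%:E <=
      \sum_(i < m) mu (S i j `&` cells R I) + #|Q|%:R%:E)%E.
    rewrite -doneS -(measure_cells R Q).
    have leQ : (\sum_(i < m) mu (S i j `&` cells R Q) <= mu (cells R Q))%E.
      apply: sum_measureI_le => //.
      by move=> i i' x; exact: parS.
    apply: le_trans (leeD2l _ leQ); rewrite -big_split /=; apply: lee_sum => i _.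
    have mD : measurable ([set (deadline (J j))%:R] : set (measurableTypeR R)).
      exact: measurable_pt.
    have mI (Q' : {set 'I_(dmax J)}) :
        measurable (S i j `&` cells R Q' : set (measurableTypeR R)).
      exact: measurableI.
    apply: (@le_trans _ _ (mu ((S i j `&` cells R I) `|` (S i j `&` cells R Q)
                               `|` [set (deadline (J j))%:R]))).
      apply: le_measure; rewrite ?inE; first exact: mSij.
        by apply: measurableU => //; exact: measurableU.
      move=> x sx; have [[t tj tx]|->] := window_job_slots (wS _ _ _ sx); last by right.
      left; have [tI|tNI] := boolP (t \in I); [left|right]; split=> //; exists t => //=.
      by rewrite /Q finset.inE tNI.
    rewrite measureU0 //; first exact: measureU2.
      exact: measurableU.
    exact: lebesgue_measure_set1.
  have [pQ|/ltnW Qp] := leqP (processing (J j)) #|Q|.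
    by rewrite (eqP pQ); apply: sume_ge0 => i _; exact: measure_ge0.
  by rewrite natrB // EFinB leeBlDr.
(* After exchanging the sums, the jobs on one machine occupy disjoint sets, so each machine offers
   at most [#|I|]. *)
rewrite -(ler_nat R) -lee_fin /demand natr_sum -sumEFin.
apply: le_trans (lee_sum _ (fun j _ => claim1 j)) _; rewrite exchange_big /=.
rewrite mulnC mulrnA -[m in leRHS]card_ord -sumr_const -sumEFin.
apply: lee_sum => i _; rewrite -(measure_cells R I).
apply: sum_measureI_le => // j j' x.
by rewrite /S /= => -> [].
Qed.

Lemma demand_feasible m :
  (forall I, (demand (job_slots J) work I <= m * #|I|)%N) -> feasible R J m.
Proof.
move=> dem.
have [I|X [XA Xp Xm]] := @capacitated_hall _ _ (job_slots J) work (fun=> m).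
  by rewrite sum_nat_const mulnC.
(* Machine [i] is idle outside all cells, and also where [onth] runs past the jobs that chose the
   cell. *)
pose s (i : 'I_m) (x : R) : option 'I_n :=
  if [pick t : 'I_(dmax J) | t%:R <= x < t.+1%:R] is Some t
  then onth (enum [set j : 'I_n | t \in X j]%SET) i else None.
have sE i j (x : R) : s i x = Some j <-> cells R (machine_slots X i j) x.
  rewrite /s; split.
    case: pickP => [t /= tx ti|//]; exists t => /=; first by rewrite finset.inE ti.
    by rewrite /cell /= in_itv.
  case=> t /= ti tx; case: pickP => [t' /= t'x|/(_ t)]; last first.
    by move: tx; rewrite /cell /= in_itv /= => ->.
  have /(cell_inj tx)/val_inj <- : cell R t' x by rewrite /cell /= in_itv.
  by move: ti; rewrite finset.inE => /eqP.
have sC i j : [set x | s i x = Some j] = cells R (machine_slots X i j).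
  by apply/seteqP; split=> x /= /sE.
exists s; split.
- by move=> i j; rewrite sC; exact: measurable_cells.
- move=> i j x /sE[t /= ti]; apply: cell_window.
  by apply: (fintype.subsetP (XA j)); apply: (fintype.subsetP (machine_slots_sub X i j)).
- move=> i i' j x /sE[t /= ti tx] /sE[t' /= ti' tx'].
  by apply/val_inj; apply: machine_slots_inj ti _; rewrite (val_inj (cell_inj tx tx')).
- move=> j; rewrite -Xp -(sum_card_machine_slots _ Xm) natr_sum -sumEFin.
  by apply: eq_bigr => i _; rewrite sC measure_cells.
Qed.

End Instance.

Theorem theorem18 (R : realType) (n : nat) (J : 'I_n -> job) :
  exists m : nat,
    minimum_machines R J m /\ m%:Z = Num.ceil (strong_density R J).
Proof.
(* Nonnegativity lets the ceiling be represented by a natural number. *)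
have dens_ge0 : 0 <= strong_density R J.
  rewrite /strong_density; elim/big_ind: _ => // [x y x0 y0|I _].
    by rewrite le_max x0.
  apply: divr_ge0; last by rewrite slots_lengthE ler0n.
  by apply: sumr_ge0 => j _; rewrite contributionE ler0n.
have [m mE] : exists m : nat, m%:Z = Num.ceil (strong_density R J).
  exists `|Num.ceil (strong_density R J)|%N; rewrite gez0_abs //.
  by rewrite -(ceil0 R) le_ceil.
(* The feasible numbers of machines are exactly the naturals not below the density, so its ceiling
   is both feasible and least. *)
have feasibleE m' : feasible R J m' <-> (m <= m')%N.
  rewrite -lez_nat mE ceil_le_int -[m'%:~R]/(m'%:R).
  split=> [h|/strong_density_leP/demand_feasible //].
  by apply/strong_density_leP => I; exact: (feasible_demand _ h).
exists m; split=> //; split; first exact/feasibleE.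
by move=> m' /feasibleE.
Qed.
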